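(* Let $n\ge 1$ and $m\ge n-1$ be integers, $\tilde m=2m+1$, and let $\gamma$ be the covariance function of a stationary complex-valued Gaussian process. Assume that the eigenvalues $\lambda_0,\dots,\lambda_{\tilde m-1}$ of the Hermitian circulant matrix $\mathbf C$ associated with $\gamma$ and $m$ are all non-negative. Let $\mathbf Z_{\tilde m}$ be the (full, length $\tilde m$) output vector of Algorithm 1, and let $\mathbf Z$ be the vector of its first $n$ components. Then $$\mathbf H_{\tilde m}:=\mathrm E(\mathbf Z_{\tilde m}\mathbf Z_{\tilde m}^\top)=\mathbf Q^*\mathbf V\mathbf Q,$$ where $\mathbf V=\mathrm{diag}(v_k,\ k=0,\dots,\tilde m-1)$ with $v_0=0$ and $v_k=\sqrt{\lambda_k\lambda_{\tilde m-k}}$ for $1\le k\le \tilde m-1$. The relation matrix $\mathbf H=\mathrm E(\mathbf Z\mathbf Z^\top)$ is the $n\times n$ top left corner of $\mathbf H_{\tilde m}$. Consequently $\mathbf Q^*\mathbf V\mathbf Q$ is a circulant matrix, and $\mathbf H$ is a Toeplitz Hermitian matrix with first row $$\mathbf H_{0k}=\frac1{\tilde m}\sum_{j=1}^{\tilde m-1}\sqrt{\lambda_j\lambda_{\tilde m-j}}\;e^{-\frac{2\mathbf i\pi jk}{\tilde m}},\qquad k=0,\dots,n-1.$$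
   Context: Notation: $\mathbf i^2=-1$; $^\top$ is transpose; $^*$ is conjugate transpose (complex conjugate for scalars). The covariance function is $\gamma(\tau)=\mathrm E\{Z(t+\tau)Z^*(t)\}$ for a zero-mean stationary complex-valued Gaussian process $Z$; it satisfies $\gamma(-\tau)=\gamma^*(\tau)$. Circulant matrix: $\mathbf C$ is the $\tilde m\times\tilde m$ circulant matrix whose first row $(c_0,\dots,c_{2m})$ is $c_0=\gamma(0)$, $c_j=\gamma^*(j)$ for $j=1,\dots,m$, and $c_j=\gamma(2m+1-j)$ for $j=m+1,\dots,2m$. It is Hermitian, with real eigenvalues $\lambda_k=\sum_{j=0}^{\tilde m-1}c_je^{-2\mathbf i\pi jk/\tilde m}$, $k=0,\dots,\tilde m-1$, and $\mathbf C=\mathbf Q\,\mathrm{diag}(\lambda_0,\dots,\lambda_{\tilde m-1})\,\mathbf Q^*$, where $(\mathbf Q)_{jk}=\tilde m^{-1/2}e^{-2\mathbf i\pi jk/\tilde m}$, $j,k=0,\dots,\tilde m-1$. Algorithm 1: let $S_0,\dots,S_m,T_0,\dots,T_m$ be mutually independent real standard Gaussian random variables. Set $$W_k=\sqrt{\frac{\lambda_k}{2\tilde m}}\,(S_k+\mathbf iT_k)\ \ (k=0,\dots,m),\qquad W_k=\sqrt{\frac{\lambda_k}{2\tilde m}}\,(S_{\tilde m-k}-\mathbf iT_{\tilde m-k})\ \ (k=m+1,\dots,\tilde m-1).$$ The output vector $\mathbf Z_{\tilde m}$ has components $(\mathbf Z_{\tilde m})_k=\sum_{j=0}^{\tilde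 m-1}W_je^{-2\mathbf i\pi jk/\tilde m}$, $k=0,\dots,\tilde m-1$. *)

(* Defs.v *)
From HB Require Import structures.
From mathcomp Require Import all_boot all_order all_algebra.
From mathcomp Require Export sesquilinear.
From mathcomp Require Import complex.
From mathcomp Require Import all_classical all_reals all_analysis.

Set Implicit Arguments.
Unset Strict Implicit.
Unset Printing Implicit Defensive.
Import Order.TTheory GRing.Theory Num.Theory.
Local Open Scope classical_set_scope.
Local Open Scope ring_scope.

Local Notation Re := complex.Re.
Local Notation Im := complex.Im.

Section ComplexRandomVariables.
Context (R : realType) (d : measure_display) (Om : measurableType d)
  (P : probability Om R).

Definition cmeasurable (X : Om -> R[i]) : Prop :=
  measurable_fun setT (fun w => Re (X w)) /\
  measurable_fun setT (fun w => Im (X w)).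

Definition cintegrable (X : Om -> R[i]) : Prop :=
  P.-integrable setT (fun w => (Re (X w))%:E) /\
  P.-integrable setT (fun w => (Im (X w))%:E).

(* Only meaningful when [cintegrable X]: [fine] sends infinite values to 0. *)
Definition cexpect (X : Om -> R[i]) : R[i] :=
  (fine 'E_P[fun w => Re (X w)] +i* fine 'E_P[fun w => Im (X w)])%C.

Definition mxexpect p q (X : Om -> 'M[R[i]]_(p, q)) : 'M[R[i]]_(p, q) :=
  \matrix_(i, j) cexpect (fun w => X w i j).

(* Constants are Gaussian; they are a separate case because [normal_prob m 0]
   is a junk value of the library, not the Dirac mass at [m]. *)
Definition gaussian (X : Om -> R) : Prop :=
  measurable_fun setT X /\
  ((exists m s : R, 0 < s /\
      forall A, measurable A -> P (X @^-1` A) = normal_prob m s A) \/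
   (exists m : R, P (X @^-1` [set m]) = 1%E)).

Definition standard_gaussian (X : {RV P >-> R}) : Prop :=
  forall A, measurable A -> distribution P X A = normal_prob 0 1 A.

Definition mutually_independent (I : finType) (X : I -> {RV P >-> R}) : Prop :=
  forall (J : {set I}) (A : I -> set R), (forall i, measurable (A i)) ->
    (P (\bigcap_(i in [set` J]) (X i @^-1` A i)) =
     \prod_(i in J) P (X i @^-1` A i))%E.

(* The ordered ring [Tm] is the set of times, e.g. [int] or [R]. *)
Section Processes.
Context (Tm : realDomainType) (Z : Tm -> Om -> R[i]).

(* Finite-dimensional laws of (Re Z, Im Z) are (possibly degenerate)
   real Gaussian vectors: all their linear combinations are Gaussian.
   Neither circularity nor any relation function is prescribed. *)
Definition complex_gaussian_process : Prop :=
  (forall t, cmeasurable (Z t)) /\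
  forall (p : nat) (t : 'I_p -> Tm) (a b : 'I_p -> R),
    gaussian (fun w => \sum_i (a i * Re (Z (t i) w) + b i * Im (Z (t i) w))).

Definition zero_mean : Prop := forall t, cexpect (Z t) = 0.

(* Strict stationarity: finite-dimensional laws are shift invariant; it is
   enough to compare them on the generating pi-system of product sets. *)
Definition stationary : Prop :=
  forall (p : nat) (t : 'I_p -> Tm) (h : Tm) (A B : 'I_p -> set R),
    (forall i, measurable (A i)) -> (forall i, measurable (B i)) ->
    P [set w | forall i, A i (Re (Z (t i + h) w)) /\ B i (Im (Z (t i + h) w))]
    = P [set w | forall i, A i (Re (Z (t i) w)) /\ B i (Im (Z (t i) w))].

Definition covariance_function (gamma : Tm -> R[i]) : Prop :=
  forall t tau, gamma tau = cexpect (fun w => Z (t + tau) w * (Z t w)^*).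

End Processes.
End ComplexRandomVariables.

Section StructuredMatrices.
Context (K : numClosedFieldType).

(* [j - i] is subtraction modulo [p.+1]; [c] is the first row. *)
Definition circulant p (c : 'rV[K]_p.+1) : 'M[K]_p.+1 :=
  \matrix_(i, j) c 0 (j - i).

Definition is_circulant p (A : 'M[K]_p.+1) : Prop := exists c, A = circulant c.

(* [A i j] depends only on [j - i], written without negative differences. *)
Definition is_toeplitz p (A : 'M[K]_p) : Prop :=
  forall i j i' j' : 'I_p, (j + i' = j' + i)%N -> A i j = A i' j'.

Definition top_left n p (le_np : (n <= p)%N) (A : 'M[K]_p) : 'M[K]_n :=
  mxsub (widen_ord le_np) (widen_ord le_np) A.

Definition first_entries n p (le_np : (n <= p)%N) (x : 'cV[K]_p) : 'cV[K]_n :=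
  rowsub (widen_ord le_np) x.

End StructuredMatrices.

Definition embed_size (m : nat) : nat := (2 * m).+1.

Lemma leq_embed_size n m : (n - 1 <= m)%N -> (n <= embed_size m)%N.
Proof.
rewrite leq_subLR add1n => /leq_trans; apply.
by rewrite ltnS mul2n -addnn leq_addr.
Qed.

Section CirculantEmbedding.
Context (R : realType) (Tm : realDomainType).

(* exp (- 2 i pi j k / N) *)
Definition dft_exp (N j k : nat) : R[i] :=
  let x := 2 * pi * j%:R * k%:R / N%:R in (cos (- x) +i* sin (- x))%C.

Definition dftmx (m : nat) : 'M[R[i]]_(embed_size m) :=
  \matrix_(j, k) ((sqrtC (embed_size m)%:R)^-1 * dft_exp (embed_size m) j k).

Context (gamma : Tm -> R[i]) (m : nat).

Definition embedding_row : 'rV[R[i]]_(embed_size m) :=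
  \row_j if (j == 0 :> nat) then gamma 0
         else if (j <= m)%N then (gamma j%:R)^*
         else gamma (embed_size m - j)%:R.

Definition embedding_mx : 'M[R[i]]_(embed_size m) := circulant embedding_row.

(* The eigenvalues of [embedding_mx], indexed by 0 <= k < embed_size m. *)
Definition embedding_eigenval (k : nat) : R[i] :=
  \sum_(j < embed_size m) embedding_mx ord0 j * dft_exp (embed_size m) j k.

Local Notation lambda := embedding_eigenval.

Definition relation_eigenval (k : nat) : R[i] :=
  if k == 0%N then 0 else sqrtC (lambda k * lambda (embed_size m - k)).

Definition relation_diag : 'M[R[i]]_(embed_size m) :=
  diag_mx (\row_k relation_eigenval k).

Context (Om : Type) (S T : 'I_m.+1 -> Om -> R).

(* In both branches the argument of [inord] is at most [m]. *)
Definition algo_weight (k : nat) (w : Om) : R[i] :=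
  sqrtC (lambda k / (2 * embed_size m)%:R) *
  (if (k <= m)%N then (S (inord k) w +i* T (inord k) w)%C
   else (S (inord (embed_size m - k)) w -i* T (inord (embed_size m - k)) w)%C).

Definition algo_output (w : Om) : 'cV[R[i]]_(embed_size m) :=
  \col_k \sum_(j < embed_size m) algo_weight j w * dft_exp (embed_size m) j k.

End CirculantEmbedding.

(* Main.v *)
Require Import Defs.
From HB Require Import structures.
From mathcomp Require Import all_boot all_order all_algebra.
From mathcomp Require Import complex.
From mathcomp Require Import all_classical all_reals all_analysis.
From mathcomp Require Import zify ring lra.
From mathcomp Require Import measurable_realfun.

Set Implicit Arguments.
Unset Strict Implicit.
Unset Printing Implicit Defensive.
Import Order.TTheory GRing.Theory Num.Theory.
Local Open Scope ring_scope.

(** Put [N = 2 m + 1] and [w = exp (- 2 i pi / N)].  Up to the real factor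
    [sqrt (lambda_j / (2 N))], the weight [W_j] of the algorithm is a complex
    Gaussian noise [z_j] with [z_(N-j) = conj z_j] for [1 <= j < N].
    Since the real variables [S] and [T] are centred, of variance one and
    pairwise uncorrelated, [E (z_j z_k)] is [2] when [j + k = N] and [0]
    otherwise ([cexpect_algo_noiseM]): the diagonal terms cancel because
    [E (S^2) = E (T^2)], and only a noise met with its own conjugate survives.
    Expanding the product of two outputs, the entry [(a, b)] of the relation
    matrix is therefore a single sum over [1 <= j < N] of [v_j / N] times
    [w^(j a) w^((N - j) b)].

    Everything else is read off the function [circ_kernel]
    [K(a, b) = 1/N sum_(1 <= j < N) v_j w^(- j a) w^(j b)]: the substitution
    [j -> N - j], under which [v] is invariant, identifies [K] with the
    relation matrix ([mxexpect_algo_output]); the definition of the unitary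
    Fourier matrix identifies [K] with [Q^* V Q] ([dftmx_conj_diag], where
    [v_0 = 0] removes the term [j = 0]); and [K] depends on [b - a] modulo [N]
    only, and is Hermitian since [v_j >= 0], which gives the circulant,
    Toeplitz and Hermitian claims.

    The probabilistic input is the pair of moments [E X = 0] and [E X^2 = 1] of
    a standard Gaussian, obtained from its density by symmetry and by an
    integration by parts, and the fact that the expectation of a product of two
    independent variables is the product of the expectations, obtained from
    Fubini's theorem for their joint law. *)

(** * Moments of the standard normal density *)

Section StandardNormalDensity.
Import numFieldNormedType.Exports.
Local Open Scope classical_set_scope.
Context (R : realType).
Local Notation mu := (@lebesgue_measure R).
Local Notation phi := (@normal_pdf R 0 1).

(** The Radon-Nikodym derivative of a normal law is almost everywhere its
    density; for nonnegative integrands no integrability is needed. *)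
Lemma ge0_integral_normal_prob (m s : R) (f : R -> \bar R) :
  (forall x, (0 <= f x)%E) -> measurable_fun setT f ->
  (\int[normal_prob m s]_x f x = \int[mu]_x (f x * (normal_pdf m s x)%:E))%E.
Proof.
move=> f0 mf; have dom := normal_prob_dominates m s.
rewrite -(Radon_Nikodym_SigmaFinite.change_of_variables dom)//.
apply: ae_eq_integral => //.
- apply: emeasurable_funM => //; apply: (measurable_int mu).
  exact: Radon_Nikodym_SigmaFinite.f_integrable.
- apply: emeasurable_funM => //; apply/measurable_EFinP.
  exact: measurable_normal_pdf.
- apply: ae_eqe_mul2l => /=.
  apply: integral_ae_eq => //=.
  + exact: Radon_Nikodym_SigmaFinite.f_integrable.
  + by apply/measurable_EFinP; exact: measurable_normal_pdf.
  + by move=> E _ mE; rewrite -Radon_Nikodym_SigmaFinite.f_integral.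
Qed.

(** Both sides are the sum of the integrals of [f] and of [f \o -%R] over the
    nonnegative half-line. *)
Lemma ge0_integral_oppr (f : R -> R) : (forall x, 0 <= f x) -> continuous f ->
  (\int[mu]_x (f x)%:E = \int[mu]_x (f (- x))%:E)%E.
Proof.
have split0 (g : R -> R) : (forall x, 0 <= g x) -> continuous g ->
    (\int[mu]_x (g x)%:E = \int[mu]_(x in `[0%R, +oo[) (g (- x))%:E
      + \int[mu]_(x in `[0%R, +oo[) (g x)%:E)%E.
  move=> g0 cg.
  have mg : measurable_fun setT g by exact: continuous_measurable_fun.
  rewrite -(setUv `[0%R, +oo[) ge0_integral_setU//=; last 4 first.
  - exact: measurableC.
  - by apply/measurable_EFinP; rewrite setUv.
  - by move=> x _; rewrite lee_fin.
  - exact/disj_setPCl.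
  rewrite addeC; congr (_ + _)%E.
  rewrite setCitvr integral_itv_bndo_bndc; last first.
    exact/measurable_EFinP/measurable_funTS.
  rewrite -{1}oppr0 ge0_integration_by_substitutionNy//.
  exact: continuous_subspaceT.
move=> f0 cf; rewrite split0// [RHS]split0.
- by rewrite addeC; congr (_ + _)%E; apply: eq_integral => x _; rewrite opprK.
- by move=> x.
- by move=> x; apply: continuous_comp; [exact: opp_continuous|exact: cf].
Qed.

Lemma std_normal_pdfE x : phi x = normal_peak 1 * expR (- x ^+ 2 / 2).
Proof. by rewrite normal_pdfE ?oner_eq0// /normal_fun subr0 expr1n. Qed.

Lemma std_normal_pdfN x : phi (- x) = phi x.
Proof. by rewrite !std_normal_pdfE sqrrN. Qed.

Lemma is_derive_std_normal_pdf (x : R) : is_derive x 1 phi (- x * phi x).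
Proof.
have -> : phi = fun x => normal_peak 1 * expR (- x ^+ 2 / 2).
  by apply/funext => y; rewrite std_normal_pdfE.
by apply: is_derive_eq; rewrite /GRing.scale/=; field.
Qed.

Lemma cvg_mul_std_normal_pdf : n%:R * phi n%:R @[n --> \oo] --> (0 : R).
Proof.
(* [expR (x ^+ 2 / 2) >= 1 + x ^+ 2 / 2] bounds [x * phi x] by a multiple of
   [x^-1]. *)
apply: (@squeeze_cvgr _ _ _ _ (cst 0)
  (fun n : nat => normal_peak 1 * 2 * n%:R^-1)).
- near=> n; rewrite mulr_ge0 ?normal_pdf_ge0//=.
  have n0 : 0 < n%:R :> R by rewrite ltr0n; near: n; exact: nbhs_infty_gt.
  rewrite std_normal_pdfE mulrCA -mulrA ler_wpM2l ?normal_peak_ge0//.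
  rewrite mulNr expRN ler_pdivrMr ?expR_gt0//.
  apply: (@le_trans _ _ (2 / n%:R * (1 + n%:R ^+ 2 / 2))); last first.
    by rewrite ler_wpM2l ?divr_ge0// expR_ge1Dx.
  rewrite mulrDr mulr1.
  have -> : 2 / n%:R * (n%:R ^+ 2 / 2) = n%:R :> R.
    by field; rewrite gt_eqF.
  by rewrite lerDr divr_ge0.
- exact: cvg_cst.
- rewrite -[X in _ --> X](mulr0 (normal_peak 1 * 2)); apply: cvgMr.
  rewrite gtr0_cvgV0; first exact: cvgr_idn.
  by near=> n; rewrite ltr0n; near: n; exact: nbhs_infty_gt.
Unshelve. all: by end_near. Qed.

(** The second moment equals the total mass: since [x * phi x] is the
    derivative of [- phi], the two integrals over [0 <= x <= n] differ by the
    boundary term [n * phi n], which tends to 0. *)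
Lemma integral_sqr_std_normal_pdf :
  (\int[mu]_x (x ^+ 2 * phi x)%:E = 1)%E.
Proof.
have cphi : continuous phi by apply: continuous_normal_pdf; exact: oner_neq0.
have csq : continuous (fun x : R => x ^+ 2 * phi x).
  by move=> x; apply: cvgM; [exact: sqr_continuous|exact: cphi].
have phi0 x : 0 <= phi x by exact: normal_pdf_ge0.
have sq0 x : 0 <= x ^+ 2 * phi x by rewrite mulr_ge0 ?sqr_ge0.
have posE : [set x : R | 0 <= x] = `[0, +oo[.
  by apply/seteqP; split => x /=; rewrite in_itv/= andbT.
rewrite -(integral_normal_pdf 0 1) ge0_symfun_integralT//; last first.
  by move=> x /=; rewrite std_normal_pdfN sqrrN.
rewrite [RHS]ge0_symfun_integralT//; last first.
  by move=> x /=; rewrite std_normal_pdfN.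
congr (_ * _)%E; rewrite posE.
have parts (n : nat) : (0 < n)%N ->
    (\int[mu]_(x in `[0%R, n%:R]) (x ^+ 2 * phi x)%:E =
     \int[mu]_(x in `[0%R, n%:R]) (phi x)%:E - (n%:R * phi n%:R)%:E)%E.
  move=> n0.
  have dNphi (x : R) : is_derive x 1 (\- phi) (x * phi x).
    have ? := is_derive_std_normal_pdf x.
    by apply: is_derive_eq; rewrite mulNr opprK.
  transitivity (\int[mu]_(x in `[0%R, n%:R]) (id x * (x * phi x))%:E)%E.
    by apply: eq_integral => x _; rewrite expr2 mulrA.
  rewrite (@integration_by_parts R id (\- phi) (cst 1)
    (fun x => x * phi x))//; first last.
  - by move=> x _; rewrite derive1E derive_val.
  - split => [x _||]; first by have [] := dNphi x.
      by apply: cvg_at_right_filter; apply: cvgN; exact: cphi.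
    by apply: cvg_at_left_filter; apply: cvgN; exact: cphi.
  - apply: continuous_subspaceT => x.
    by apply: cvgM; [exact: cvg_id|exact: cphi].
  - by move=> x _; rewrite derive1E derive_id.
  - split => [x _||]; first exact: derivable_id.
      exact: cvg_at_right_filter.
    exact: cvg_at_left_filter.
  - by apply: continuous_subspaceT => x; exact: cvg_cst.
  - by rewrite ltr0n.
  rewrite /= mul0r subr0 mulrN EFinN.
  under eq_integral do rewrite mul1r EFinN.
  rewrite integral_ge0N//; last by move=> x _; rewrite lee_fin.
  by rewrite oppeK addeC.
have mphi : measurable_fun [set: R] phi by exact: measurable_normal_pdf.
have msq : measurable_fun [set: R] (fun x : R => x ^+ 2 * phi x).
  exact: continuous_measurable_fun.
have Lsq := @ge0_cvgn_integral R mu _ sq0 msq.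
have Lphi := @ge0_cvgn_integral R mu _ phi0 mphi.
have Lsq' : (\int[mu]_(x in `[0%R, n%:R]) (x ^+ 2 * phi x)%:E @[n --> \oo] -->
    \int[mu]_(x in `[0%R, +oo[) (phi x)%:E)%E.
  rewrite -[Y in _ --> Y]sube0.
  have L : (\int[mu]_(x in `[0%R, n%:R]) (phi x)%:E - (n%:R * phi n%:R)%:E
      @[n --> \oo] --> \int[mu]_(x in `[0%R, +oo[) (phi x)%:E - 0)%E.
    apply: cvgeB; [by rewrite fin_num_adde_defl|exact: Lphi|].
    by apply: cvg_EFin; [near=> n|exact: cvg_mul_std_normal_pdf].
  apply: cvg_trans L; apply: near_eq_cvg.
  by near=> n; rewrite parts//; near: n; exact: nbhs_infty_gt.
exact: (cvg_unique _ Lsq Lsq').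
Unshelve. all: by end_near. Qed.

End StandardNormalDensity.

(** * Independent standard Gaussian random variables *)

Section GaussianVariables.
Import numFieldNormedType.Exports.
Local Open Scope classical_set_scope.
Context (R : realType) (d : measure_display) (Om : measurableType d)
  (P : probability Om R).
Local Notation mu := (@lebesgue_measure R).

Lemma ge0_integral_standard_gaussian (X : {RV P >-> R}) (f : R -> R) :
  standard_gaussian X -> (forall x, 0 <= f x) -> measurable_fun setT f ->
  (\int[P]_w (f (X w))%:E = \int[mu]_x (f x * normal_pdf 0 1 x)%:E)%E.
Proof.
move=> gX f0 mf.
have mEf : measurable_fun setT (EFin \o f) by exact/measurable_EFinP.
(* [distribution P X] and [normal_prob 0 1] live on two measurable structures
   on [R] with the same measurable sets; pushing [P] forward to the second
   structure makes the two laws comparable. *)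
have mX : measurable_fun setT (X : Om -> measurableTypeR R).
  by move=> mD Y mY; exact: (@measurable_funPT _ _ _ _ X).
have := @ge0_integral_pushforward _ _ Om (measurableTypeR R) R X mX P setT
  (EFin \o f).
rewrite preimage_setT => <-//; last by move=> y _; rewrite lee_fin.
rewrite (eq_measure_integral (normal_prob 0 1))/=; last first.
  by move=> A mA _; exact: gX.
by rewrite ge0_integral_normal_prob// => x; rewrite lee_fin.
Qed.

Lemma integral_sqr_standard_gaussian (X : {RV P >-> R}) :
  standard_gaussian X -> (\int[P]_w (X w ^+ 2)%:E = 1)%E.
Proof.
move=> gX; rewrite (ge0_integral_standard_gaussian gX (f := fun x => x ^+ 2)).
- exact: integral_sqr_std_normal_pdf.
- by move=> x; exact: sqr_ge0.
- exact: measurable_funX.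
Qed.

Lemma integrable_sqr_standard_gaussian (X : {RV P >-> R}) :
  standard_gaussian X -> P.-integrable setT (fun w => (X w ^+ 2)%:E).
Proof.
move=> gX; apply/integrableP; split.
  by apply/measurable_EFinP; apply: measurable_funX.
under eq_integral do rewrite gee0_abs ?lee_fin ?sqr_ge0//.
by rewrite integral_sqr_standard_gaussian// ltry.
Qed.

Lemma integrable_sqr_mul (X Y : {RV P >-> R}) :
  P.-integrable setT (fun w => (X w ^+ 2)%:E) ->
  P.-integrable setT (fun w => (Y w ^+ 2)%:E) ->
  P.-integrable setT (fun w => (X w * Y w)%:E).
Proof.
move=> iX iY.
(* [|x y| <= x ^+ 2 + y ^+ 2] *)
apply: (le_integrable measurableT _ _ (integrableD measurableT iX iY)).
  by apply/measurable_EFinP; exact: measurable_funM.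
move=> w _ /=; rewrite lee_fin (ger0_norm (addr_ge0 (sqr_ge0 _) (sqr_ge0 _))).
by rewrite ler_norml; apply/andP; split; nra.
Qed.

Lemma integrable_sqr_id (X : {RV P >-> R}) :
  P.-integrable setT (fun w => (X w ^+ 2)%:E) ->
  P.-integrable setT (fun w => (X w)%:E).
Proof.
move=> iX.
have i1 : P.-integrable setT (fun w => ((cst 1 : {RV P >-> R}) w ^+ 2)%:E).
  rewrite /= expr1n; exact: finite_measure_integrable_cst.
by have := integrable_sqr_mul iX i1; under eq_fun do rewrite mulr1.
Qed.

(** The positive and the negative part of [X] have the same integral because
    the density is even. *)
Lemma integral_standard_gaussian (X : {RV P >-> R}) :
  standard_gaussian X -> (\int[P]_w (X w)%:E = 0)%E.
Proof.
move=> gX; rewrite integralE.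
pose p (x : R) := Num.max x 0; pose q (x : R) := Num.max (- x) 0.
have cp : continuous p.
  move=> x; apply: (@continuous_max _ _ id (cst 0)); first exact: cvg_id.
  exact: cvg_cst.
have cq : continuous q.
  move=> x; apply: (@continuous_comp _ _ _ (-%R : R -> R) p); last exact: cp.
  exact: opp_continuous.
have p0 x : 0 <= p x by rewrite le_max lexx orbT.
have q0 x : 0 <= q x by exact: p0.
have cphi : continuous (@normal_pdf R 0 1).
  by apply: continuous_normal_pdf; exact: oner_neq0.
have E : (\int[P]_w (p (X w))%:E = \int[P]_w (q (X w))%:E)%E.
  rewrite !(ge0_integral_standard_gaussian gX)//;
    try exact: continuous_measurable_fun.
  rewrite ge0_integral_oppr; last first.
  - by move=> x; apply: cvgM; [exact: cp|exact: cphi].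
  - by move=> x; rewrite mulr_ge0 ?normal_pdf_ge0.
  by apply: eq_integral => x _; rewrite std_normal_pdfN.
have iX := integrable_sqr_id (integrable_sqr_standard_gaussian gX).
have posE :
    (\int[P]_w ((fun w => (X w)%:E)^\+)%E w = \int[P]_w (p (X w))%:E)%E.
  by apply: eq_integral => w _; rewrite funeposE EFin_max.
have negE :
    (\int[P]_w ((fun w => (X w)%:E)^\-)%E w = \int[P]_w (q (X w))%:E)%E.
  by apply: eq_integral => w _; rewrite funenegE EFin_max.
rewrite posE negE -E subee// -posE.
exact: integrable_fin_num (integrable_funepos measurableT iX).
Qed.

(** By independence the joint law of [(X, Y)] is the product of the laws of [X]
    and [Y], to which Fubini's theorem applies. *)
Lemma integral_mul_indep (X Y : {RV P >-> R}) :
  (forall A B : set R, measurable A -> measurable B ->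
     P (X @^-1` A `&` Y @^-1` B) = (P (X @^-1` A) * P (Y @^-1` B))%E) ->
  P.-integrable setT (fun w => (X w)%:E) ->
  P.-integrable setT (fun w => (Y w)%:E) ->
  P.-integrable setT (fun w => (X w * Y w)%:E) ->
  (\int[P]_w (X w * Y w)%:E = (\int[P]_w (X w)%:E) * \int[P]_w (Y w)%:E)%E.
Proof.
move=> indep iX iY iXY.
pose XY w := (X w, Y w).
have mXY : measurable_fun setT XY by apply: measurable_fun_pair.
pose f (z : R * R) := (z.1 * z.2)%:E.
have mf : measurable_fun setT f.
  by apply/measurable_EFinP; apply: measurable_funM.
pose m1 := distribution P X; pose m2 := distribution P Y.
have eq_law (g : R * R -> \bar R) :
    (\int[pushforward P XY]_z g z = \int[m1 \x m2]_z g z)%E.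
  apply: eq_measure_integral => A mA _; apply/esym.
  exact: (@product_measure_unique _ _ _ _ _ m1 m2 (pushforward P XY)).
have intf : (m1 \x m2)%E.-integrable setT f.
  apply/integrableP; split => //; rewrite -eq_law.
  by have /integrableP[] := integrable_pushforward mXY mf iXY measurableT.
transitivity (\int[pushforward P XY]_z f z)%E.
  by rewrite integral_pushforward.
rewrite eq_law -integral12_prod_meas1//.
have EY : (\int[P]_w (Y w)%:E \is a fin_num)%E by exact: integrable_fin_num iY.
have inner x : (fubini_F m2 f x = x%:E * \int[P]_w (Y w)%:E)%E.
  rewrite /fubini_F (@integral_distribution _ _ _ _ _ P Y (fun y => f (x, y))).
  - by under eq_integral do rewrite /f/= EFinM; rewrite integralZl.
  - exact: measurableT_comp.
  - apply: (eq_integrable _ (fun w => x%:E * (Y w)%:E)%E) => //.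
    exact: integrableZl.
under eq_integral do rewrite inner.
rewrite (@integral_distribution _ _ _ _ _ P X
  (fun x => x%:E * \int[P]_w (Y w)%:E)%E).
- by rewrite -(fineK EY) /= integralZr.
- by apply: emeasurable_funM.
- by rewrite -(fineK EY); exact: integrableZr.
Qed.
Lemma mutually_independent_pair (I : finType) (X : I -> {RV P >-> R}) (a b : I) :
  mutually_independent X -> a != b ->
  forall A B : set R, measurable A -> measurable B ->
  P (X a @^-1` A `&` X b @^-1` B) = (P (X a @^-1` A) * P (X b @^-1` B))%E.
Proof.
move=> indep ab A B mA mB.
have ba : (b == a) = false by rewrite eq_sym (negbTE ab).
have := indep [set a; b]%SET (fun i => if i == a then A else B).
rewrite big_setU1 ?inE//= big_set1 eqxx ba => <-; last by move=> i; case: ifP.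
congr (P _); apply/seteqP; split=> [w [Aw Bw] i|w H].
  by rewrite /= !inE => /orP[/eqP ->|/eqP ->]; rewrite ?eqxx ?ba.
have /= := H a; rewrite !inE eqxx => /(_ isT) Aw.
by have /= := H b; rewrite !inE eqxx orbT ba => /(_ isT) Bw.
Qed.

Section Family.
Context (I : finType) (g : I -> {RV P >-> R})
  (gaussg : forall i, standard_gaussian (g i))
  (indg : mutually_independent g).

Lemma integrable_gaussian_mul a b :
  P.-integrable setT (fun w => (g a w * g b w)%:E).
Proof.
by apply: integrable_sqr_mul; exact: integrable_sqr_standard_gaussian.
Qed.

Lemma Rintegral_gaussian_mul a b :
  (\int[P]_w (g a w * g b w))%R = (a == b)%:R.
Proof.
rewrite /Rintegral; have [<-|ab] := eqVneq a b.
  under eq_integral do rewrite -expr2.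
  by rewrite integral_sqr_standard_gaussian.
rewrite integral_mul_indep.
- by rewrite integral_standard_gaussian// mul0e.
- exact: mutually_independent_pair.
- by apply: integrable_sqr_id; exact: integrable_sqr_standard_gaussian.
- by apply: integrable_sqr_id; exact: integrable_sqr_standard_gaussian.
- exact: integrable_gaussian_mul.
Qed.

End Family.

End GaussianVariables.

(** * Linearity of the complex expectation *)

Local Notation Re := complex.Re.
Local Notation Im := complex.Im.

Section ComplexExpectation.
Context (R : realType) (d : measure_display) (Om : measurableType d)
  (P : probability Om R).

Lemma cexpectE (X : Om -> R[i]) : cexpect P X =
  ((\int[P]_w Re (X w))%R +i* (\int[P]_w Im (X w))%R)%C.
Proof. by rewrite /cexpect unlock. Qed.

Lemma cintegrable_cst0 : cintegrable P (fun _ => 0).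
Proof. by split; apply: finite_measure_integrable_cst. Qed.

Lemma cintegrableD (X Y : Om -> R[i]) : cintegrable P X -> cintegrable P Y ->
  cintegrable P (fun w => X w + Y w).
Proof.
move=> [X1 X2] [Y1 Y2]; split.
- apply: (eq_integrable _ (fun w => (Re (X w))%:E + (Re (Y w))%:E)%E) => //.
  + by move=> w _; rewrite raddfD.
  + exact: integrableD.
- apply: (eq_integrable _ (fun w => (Im (X w))%:E + (Im (Y w))%:E)%E) => //.
  + by move=> w _; rewrite raddfD.
  + exact: integrableD.
Qed.

Lemma cexpectD (X Y : Om -> R[i]) : cintegrable P X -> cintegrable P Y ->
  cexpect P (fun w => X w + Y w) = cexpect P X + cexpect P Y.
Proof.
move=> [X1 X2] [Y1 Y2]; rewrite !cexpectE.
under eq_Rintegral do rewrite raddfD.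
under [X in (_ +i* X)%C]eq_Rintegral do rewrite raddfD.
by rewrite !RintegralD.
Qed.

Lemma ReM (x y : R[i]) : Re (x * y) = Re x * Re y - Im x * Im y.
Proof. by case: x y => ? ? [? ?]. Qed.

Lemma ImM (x y : R[i]) : Im (x * y) = Re x * Im y + Im x * Re y.
Proof. by case: x y => ? ? [? ?]. Qed.

Lemma cintegrableZ (c : R[i]) (X : Om -> R[i]) : cintegrable P X ->
  cintegrable P (fun w => c * X w).
Proof.
move=> [X1 X2]; split.
- apply: (eq_integrable _
    (fun w => (Re c)%:E * (Re (X w))%:E - (Im c)%:E * (Im (X w))%:E)%E) => //.
  + by move=> w _; rewrite ReM EFinB !EFinM.
  + by apply: integrableB => //; exact: integrableZl.
- apply: (eq_integrable _
    (fun w => (Re c)%:E * (Im (X w))%:E + (Im c)%:E * (Re (X w))%:E)%E) => //.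
  + by move=> w _; rewrite ImM EFinD !EFinM.
  + by apply: integrableD => //; exact: integrableZl.
Qed.

Lemma cexpectZ (c : R[i]) (X : Om -> R[i]) : cintegrable P X ->
  cexpect P (fun w => c * X w) = c * cexpect P X.
Proof.
move=> [X1 X2]; rewrite !cexpectE.
under eq_Rintegral do rewrite ReM.
under [X in (_ +i* X)%C]eq_Rintegral do rewrite ImM.
have Z (a : R) (f : Om -> R) : P.-integrable setT (EFin \o f) ->
    P.-integrable setT (fun w => (a * f w)%:E).
  move=> fi; apply: (eq_integrable _ (fun w => a%:E * (f w)%:E)%E) => //.
  exact: integrableZl.
rewrite RintegralB//; [|exact: Z..].
rewrite RintegralD//; [|exact: Z..].
by rewrite !RintegralZl//; case: c.
Qed.

Lemma cintegrable_sum (I : Type) (r : seq I) (F : I -> Om -> R[i]) :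
  (forall i, cintegrable P (F i)) ->
  cintegrable P (fun w => \sum_(i <- r) F i w).
Proof.
move=> iF; elim: r => [|i r IH].
  by under eq_fun do rewrite big_nil; exact: cintegrable_cst0.
by under eq_fun do rewrite big_cons; exact: cintegrableD.
Qed.

Lemma cexpect_sum (I : Type) (r : seq I) (F : I -> Om -> R[i]) :
  (forall i, cintegrable P (F i)) ->
  cexpect P (fun w => \sum_(i <- r) F i w) = \sum_(i <- r) cexpect P (F i).
Proof.
move=> iF; elim: r => [|i r IH].
  under eq_fun do rewrite big_nil.
  rewrite big_nil cexpectE; under eq_Rintegral do rewrite /=.
  by rewrite !Rintegral_cst//= !mul0r.
under eq_fun do rewrite big_cons.
by rewrite big_cons cexpectD//; [rewrite IH|exact: cintegrable_sum].
Qed.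

End ComplexExpectation.

(** * Roots of unity and circulant kernels *)

Section DiscreteFourier.
Context (R : realType).

(** The root of unity [exp (- 2 i pi / N)]; its powers are the coefficients of
    the discrete Fourier transform. *)
Definition dft_root (N : nat) : R[i] := dft_exp R N 1 1.

Let cis (x : R) : R[i] := (cos x +i* sin x)%C.

Let cisD x y : cis (x + y) = cis x * cis y.
Proof. by rewrite /cis cosD sinD /=; congr (_ +i* _)%C; rewrite addrC. Qed.

Let cisMn x n : cis (x *+ n) = cis x ^+ n.
Proof.
elim: n => [|n IH]; first by rewrite /cis mulr0n cos0 sin0 expr0.
by rewrite mulrS cisD IH exprS.
Qed.

Lemma dft_expE N j k : dft_exp R N j k = dft_root N ^+ (j * k).
Proof.
rewrite -cisMn /dft_exp /= -/(cis _); congr cis.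
by rewrite mulNrn -(mulr_natr _ (j * k)) natrM !mulr1; congr (- _); ring.
Qed.

Lemma dft_root_expN N : (0 < N)%N -> dft_root N ^+ N = 1.
Proof.
move=> N0.
rewrite -cisMn mulr1 mulr1 mulNrn -[X in - X]mulr_natr divfK; last first.
  by rewrite pnatr_eq0 -lt0n.
by rewrite /cis cosN sinN mulr_natl cos2pi sin2pi oppr0.
Qed.

Lemma norm_dft_root N : `|dft_root N| = 1.
Proof. by rewrite normc_def /= cos2Dsin2 sqrtr1. Qed.

Lemma dft_root_neq0 N : dft_root N != 0.
Proof. by rewrite -normr_eq0 norm_dft_root oner_eq0. Qed.

Lemma conj_dft_root_exp N n : ((dft_root N ^+ n)^* = (dft_root N ^+ n)^-1)%R.
Proof.
have nz : dft_root N ^+ n != 0 by rewrite expf_neq0// dft_root_neq0.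
apply: (mulfI nz); rewrite -normCK divff//.
by rewrite normrX norm_dft_root !expr1n.
Qed.

Lemma dft_root_exp_compl N j a : (j <= N)%N -> (0 < N)%N ->
  dft_root N ^+ ((N - j) * a) = (dft_root N ^+ (j * a))^-1.
Proof.
move=> jN N0.
have nz : dft_root N ^+ (j * a) != 0 by rewrite expf_neq0// dft_root_neq0.
apply: (mulfI nz); rewrite divff// -exprD -mulnDl subnKC//.
by rewrite exprM dft_root_expN// expr1n.
Qed.

Lemma sum_nat_compl (V : nmodType) N (F : nat -> V) :
  \sum_(1 <= j < N) F j = \sum_(1 <= j < N) F (N - j)%N.
Proof. by rewrite big_nat_rev /=; apply: eq_bigr => j _; rewrite add1n subSS. Qed.

(** The index [j = 0] drops out: no [k < N] satisfies [0 + k = N]. *)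
Lemma sum_antidiag (V : pzSemiRingType) N (F : nat -> nat -> V) :
  \sum_(j < N) \sum_(k < N) F j k * (j + k == N)%N%:R =
  \sum_(1 <= j < N) F j (N - j)%N.
Proof.
case: N => [|N]; first by rewrite big_ord0 big_geq.
pose G j := \sum_(k < N.+1) F j k * (j + k == N.+1)%N%:R.
rewrite -(big_mkord xpredT G) big_ltn// /G big1 ?add0r => [|k _]; last first.
  by rewrite add0n ltn_eqF ?mulr0.
rewrite big_nat_cond [RHS]big_nat_cond.
apply: eq_bigr => j /andP[/andP[j1 jN] _].
rewrite -(big_mkord xpredT (fun k => F j k * (j + k == N.+1)%N%:R)).
rewrite (eq_bigr (fun k => if k == (N.+1 - j)%N then F j k else 0)) => [|k _].
  by rewrite -big_mkcond big_nat1_eq /= ifT// ltn_subrL j1.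
have -> : (j + k == N.+1)%N = (k == N.+1 - j)%N.
  by rewrite -(eqn_add2l j k) subnKC// ltnW.
by case: eqP => _; rewrite ?mulr1 ?mulr0.
Qed.

(** The entry [(a, b)] of the circulant matrix of size [N] whose eigenvalues
    are [0] at index [0] and [v j] at index [1 <= j < N].  The indices [a] and
    [b] are arbitrary natural numbers, not reduced modulo [N]. *)
Definition circ_kernel (N : nat) (v : nat -> R[i]) (a b : nat) : R[i] :=
  N%:R^-1 * \sum_(1 <= j < N)
    v j * ((dft_root N ^+ (j * a))^-1 * dft_root N ^+ (j * b)).

Lemma circ_kernel_diff N v a b a' b' : (b + a' = b' + a)%N ->
  circ_kernel N v a b = circ_kernel N v a' b'.
Proof.
move=> E; congr (_ * _); apply: eq_bigr => j _; congr (_ * _).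
have nz n : dft_root N ^+ n != 0 by rewrite expf_neq0// dft_root_neq0.
apply: (mulfI (nz (j * a)%N)); apply: (mulfI (nz (j * a')%N)).
rewrite mulVKf// mulrCA mulVKf// -!exprD -!mulnDr.
by rewrite addnC E addnC.
Qed.

Lemma circ_kernel_mod N v a b : (0 < N)%N ->
  circ_kernel N v a (b %% N) = circ_kernel N v a b.
Proof.
move=> N0; congr (_ * _); apply: eq_bigr => j _; congr (_ * (_ * _)).
rewrite [in RHS](divn_eq b N) mulnDr exprD (mulnC _ N) mulnCA (exprM _ N).
by rewrite dft_root_expN// expr1n mul1r.
Qed.

Lemma circ_kernel_conj N v a b : (forall j, (0 < j < N)%N -> 0 <= v j) ->
  (circ_kernel N v b a)^* = circ_kernel N v a b.
Proof.
move=> v0; rewrite /circ_kernel rmorphM fmorphV rmorph_nat rmorph_sum.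
congr (_ * _).
rewrite big_nat_cond [RHS]big_nat_cond; apply: eq_bigr => j /andP[/v0 vj _].
rewrite !rmorphM fmorphV /= !conj_dft_root_exp invrK mulrC.
by rewrite (CrealP (ger0_real vj)) mulrC [_^-1 * _]mulrC.
Qed.

Lemma circ_kernel_sym N v a b : (forall j, (0 < j < N)%N -> v (N - j)%N = v j) ->
  circ_kernel N v a b = N%:R^-1 * \sum_(1 <= j < N)
    v j * (dft_root N ^+ (j * a) * dft_root N ^+ ((N - j) * b)).
Proof.
move=> vs; congr (_ * _); rewrite sum_nat_compl.
rewrite big_nat_cond [RHS]big_nat_cond.
apply: eq_bigr => j /andP[/andP[j1 jN] _].
rewrite vs ?j1//; congr (_ * _).
have N0 : (0 < N)%N by exact: leq_ltn_trans jN.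
by rewrite dft_root_exp_compl// ?invrK// ltnW.
Qed.

Lemma circ_kernel_circulant p v (A : 'M[R[i]]_p.+1) :
  (forall i j, A i j = circ_kernel p.+1 v i j) -> is_circulant A.
Proof.
move=> AE; exists (\row_k circ_kernel p.+1 v 0 k).
apply/matrixP => i j; rewrite AE !mxE /= modnDmr circ_kernel_mod//.
(* modulo [p.+1], the difference [j - i] is represented by [j + (p.+1 - i)], so
   that the column [j] has to be shifted by a full period *)
rewrite -circ_kernel_mod// -modnDr circ_kernel_mod//.
apply: circ_kernel_diff; rewrite addn0 -addnA subnK//; exact: ltnW.
Qed.

End DiscreteFourier.

(** * Second moments of the complex noise *)

Section AlgorithmNoise.
Context (R : realType) (d : measure_display) (Om : measurableType d)
  (P : probability Om R) (m : nat) (S T : 'I_m.+1 -> {RV P >-> R}).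
Local Notation N := (embed_size m).
Local Notation I := ('I_m.+1 + 'I_m.+1)%type.
Local Notation g := (fun i : I => match i with inl k => S k | inr k => T k end).
Context (gaussS : forall k, standard_gaussian (S k))
  (gaussT : forall k, standard_gaussian (T k))
  (indepST : mutually_independent (I := I) g).

(** The random factor of the [j]-th weight of the algorithm, without its real
    scale: [S_j + i T_j] if [j <= m], and the conjugate of the noise of index
    [N - j] if [m < j < N]. *)
Definition algo_noise (j : nat) (w : Om) : R[i] :=
  if (j <= m)%N then (S (inord j) w +i* T (inord j) w)%C
  else (S (inord (N - j)) w -i* T (inord (N - j)) w)%C.

(* The noise [j] uses the variables of index [ix j]; [sgn j] is the sign of its
   imaginary part. *)
Let fold (j : nat) : nat := if (j <= m)%N then j else (N - j)%N.
Let ix (j : nat) : 'I_m.+1 := inord (fold j).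
Let sgn (j : nat) : R := if (j <= m)%N then 1 else -1.

Let algo_noiseE j w : algo_noise j w = (S (ix j) w +i* (sgn j * T (ix j) w))%C.
Proof.
by rewrite /algo_noise /ix /fold /sgn; case: ifP => _; rewrite ?mul1r ?mulN1r.
Qed.

Let eq_ix j k : (j < N)%N -> (k < N)%N -> (ix j == ix k) = (fold j == fold k).
Proof.
have foldm i : (i < N)%N -> (fold i < m.+1)%N.
  by rewrite /fold /embed_size; case: ifP => //; lia.
by move=> jN kN; rewrite -val_eqE /= !inordK ?foldm.
Qed.

Let gaussg i : standard_gaussian (g i). Proof. by case: i. Qed.

Let intg a b := integrable_gaussian_mul gaussg a b.
Let expg a b := Rintegral_gaussian_mul gaussg indepST a b.

Let intZ (c : R) a b : P.-integrable setT (fun w => (c * (g a w * g b w))%:E).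
Proof.
apply: (eq_integrable _ (fun w => c%:E * (g a w * g b w)%:E)%E) => //.
by apply: integrableZl => //; exact: intg.
Qed.

Let comb (c c' : R) (a b a' b' : I)
    (h := fun w => c * (g a w * g b w) + c' * (g a' w * g b' w)) :
  P.-integrable setT (fun w => (h w)%:E) /\
  (\int[P]_w h w)%R = c * (a == b)%:R + c' * (a' == b')%:R.
Proof.
split.
  apply: (eq_integrable _ (fun w =>
    (c * (g a w * g b w))%:E + (c' * (g a' w * g b' w))%:E)%E) => //.
  by apply: integrableD => //; exact: intZ.
rewrite RintegralD//; [|exact: intZ..].
by rewrite !RintegralZl// ?expg//; exact: intg.
Qed.

Let Re_algo_noiseM j k w : Re (algo_noise j w * algo_noise k w) =
  1 * (g (inl (ix j)) w * g (inl (ix k)) w) +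
  (- (sgn j * sgn k)) * (g (inr (ix j)) w * g (inr (ix k)) w).
Proof. by rewrite !algo_noiseE /=; ring. Qed.

Let Im_algo_noiseM j k w : Im (algo_noise j w * algo_noise k w) =
  sgn k * (g (inl (ix j)) w * g (inr (ix k)) w) +
  sgn j * (g (inr (ix j)) w * g (inl (ix k)) w).
Proof. by rewrite !algo_noiseE /=; ring. Qed.

Lemma cintegrable_algo_noiseM j k :
  cintegrable P (fun w => algo_noise j w * algo_noise k w).
Proof.
split.
- under eq_fun do rewrite Re_algo_noiseM.
  exact: (comb 1 (- (sgn j * sgn k)) (inl _) (inl _) (inr _) (inr _)).1.
- under eq_fun do rewrite Im_algo_noiseM.
  exact: (comb (sgn k) (sgn j) (inl _) (inr _) (inr _) (inl _)).1.
Qed.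

(** The imaginary part only involves products of some [S] by some [T].  In the
    real part [S S' - sgn j sgn k T T'], the products [S S'] and [T T'] have the
    same expectation, so that the total vanishes unless the noises share their
    variables with opposite signs, which means [j + k = N]. *)
Lemma cexpect_algo_noiseM j k : (j < N)%N -> (k < N)%N ->
  cexpect P (fun w => algo_noise j w * algo_noise k w) =
  2 * (j + k == N)%N%:R.
Proof.
move=> jN kN; rewrite cexpectE.
under eq_Rintegral do rewrite Re_algo_noiseM.
under [X in (_ +i* X)%C]eq_Rintegral do rewrite Im_algo_noiseM.
rewrite (comb 1 (- (sgn j * sgn k)) (inl _) (inl _) (inr _) (inr _)).2.
rewrite (comb (sgn k) (sgn j) (inl _) (inr _) (inr _) (inl _)).2.
rewrite !mulr0 addr0.
rewrite -[inl _ == inl _]/(ix j == ix k) -[inr _ == inr _]/(ix j == ix k).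
rewrite eq_ix// /fold /sgn; move: jN kN; rewrite /embed_size => jN kN.
have -> : (2 * (j + k == (2 * m).+1)%N%:R : R[i]) =
    ((2 * (j + k == (2 * m).+1)%N)%:R)%:C%C.
  by rewrite rmorph_nat natrM.
congr (_ +i* _)%C.
case: (leqP j m) => jm; case: (leqP k m) => km.
- by rewrite mulr1 mul1r mulN1r subrr (_ : (_ + _ == _)%N = false) ?muln0//; lia.
- rewrite (_ : (j == _)%N = (j + k == (2 * m).+1)%N); last by apply/eqP/eqP; lia.
  by case: eqP => _; rewrite /= ?muln0 ?muln1; ring.
- rewrite (_ : (_ == k)%N = (j + k == (2 * m).+1)%N); last by apply/eqP/eqP; lia.
  by case: eqP => _; rewrite /= ?muln0 ?muln1; ring.
- rewrite (_ : (j + k == _)%N = false); last by lia.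
  by rewrite muln0; ring.
Qed.

End AlgorithmNoise.

(** * The relation matrix of the output *)

Local Open Scope sesquilinear_scope.

Lemma mul_sqrtC_scaled (R : realType) (x y c : R[i]) :
  0 <= x -> 0 <= y -> 0 <= c ->
  sqrtC (x * c) * sqrtC (y * c) = sqrtC (x * y) * c.
Proof.
by move=> x0 y0 c0; rewrite !sqrtCM ?qualifE//= mulrACA -expr2 sqrtCK.
Qed.

Section RelationEigenvalues.
Context (R : realType) (Tm : realDomainType) (gamma : Tm -> R[i]) (m : nat).
Local Notation N := (embed_size m).

Lemma relation_eigenval_ge0 (j : nat) :
  (forall k : 'I_N, 0 <= embedding_eigenval gamma m k) ->
  (0 < j < N)%N -> 0 <= relation_eigenval gamma m j.
Proof.
move=> l0 /andP[j0 jN]; rewrite /relation_eigenval gtn_eqF// sqrtC_ge0.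
have jN' : (N - j < N)%N by rewrite ltn_subrL j0.
by rewrite mulr_ge0// ?(l0 (Ordinal jN)) ?(l0 (Ordinal jN')).
Qed.

Lemma relation_eigenvalC (j : nat) : (0 < j < N)%N ->
  relation_eigenval gamma m (N - j) = relation_eigenval gamma m j.
Proof.
move=> /andP[j0 jN]; rewrite /relation_eigenval gtn_eqF ?subn_gt0// gtn_eqF//.
by rewrite subKn 1?mulrC// ltnW.
Qed.

End RelationEigenvalues.

(** The term of index [0] of the product vanishes, which is why the sum in
    [circ_kernel] may start at [1]. *)
Lemma dftmx_conj_diag (R : realType) (m : nat) (v : nat -> R[i])
    (N := embed_size m) (a b : 'I_N) : v 0%N = 0 ->
  ((dftmx R m) ^t Num.conj *m diag_mx (\row_k v k) *m dftmx R m) a b =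
  circ_kernel N v a b.
Proof.
move=> v0; rewrite mul_mx_diag !mxE.
pose F (j : nat) :=
  v j * ((dft_root R N ^+ (j * a))^-1 * dft_root R N ^+ (j * b)).
transitivity (\sum_(j < N) N%:R^-1 * F j).
  apply: eq_bigr => j _.
  rewrite !mxE !dft_expE rmorphM fmorphV /= conj_dft_root_exp.
  rewrite [X in X^-1 * _ * _](CrealP _); last by rewrite realE sqrtC_ge0 ler0n.
  have <- : (sqrtC N%:R)^-1 * (sqrtC N%:R)^-1 = N%:R^-1 :> R[i].
    by rewrite -invfM -expr2 sqrtCK.
  by rewrite /F; ring.
rewrite -mulr_sumr -(big_mkord xpredT F).
by rewrite big_ltn// /F v0 mul0r add0r.
Qed.

Section OutputRelation.
Context (R : realType) (Tm : realDomainType) (gamma : Tm -> R[i]) (m : nat).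
Context (d : measure_display) (Om : measurableType d) (P : probability Om R)
  (S T : 'I_m.+1 -> {RV P >-> R}).
Local Notation N := (embed_size m).
Local Notation lambda := (embedding_eigenval gamma m).
Local Notation Zt := (algo_output gamma S T).

Lemma algo_outputM (a b : 'I_N) w : (Zt w *m (Zt w)^T) a b =
  \sum_(j < N) \sum_(k < N)
   (sqrtC (lambda j / (2 * N)%:R) * sqrtC (lambda k / (2 * N)%:R) *
    (dft_root R N ^+ (j * a) * dft_root R N ^+ (k * b))) *
   (algo_noise S T j w * algo_noise S T k w).
Proof.
rewrite !mxE big_ord1 !mxE big_distrlr.
apply: eq_bigr => j _; apply: eq_bigr => k _; rewrite !dft_expE.
have rearrange (s z e s' z' e' : R[i]) :
  (s * z) * e * ((s' * z') * e') = s * s' * (e * e') * (z * z') by ring.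
exact: rearrange.
Qed.

(** The scales of the weights satisfy
    [2 sqrt (lambda_j / (2 N)) sqrt (lambda_(N-j) / (2 N)) = v_j / N], where the
    factor [2] is the second moment of the noise. *)
Lemma mxexpect_algo_output
    (lambda_ge0 : forall k : 'I_N, 0 <= lambda k)
    (gaussS : forall k, standard_gaussian (S k))
    (gaussT : forall k, standard_gaussian (T k))
    (indepST : mutually_independent (I := ('I_m.+1 + 'I_m.+1)%type)
       (fun i => match i with inl k => S k | inr k => T k end)) (a b : 'I_N) :
  cintegrable P (fun w => (Zt w *m (Zt w)^T) a b) /\
  cexpect P (fun w => (Zt w *m (Zt w)^T) a b) =
    circ_kernel N (relation_eigenval gamma m) a b.
Proof.
under [X in cintegrable P X]eq_fun do rewrite algo_outputM.
under [X in cexpect P X]eq_fun do rewrite algo_outputM.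
have intZ c (j k : nat) :
    cintegrable P (fun w => c * (algo_noise S T j w * algo_noise S T k w)).
  by apply: cintegrableZ; exact: cintegrable_algo_noiseM.
split; first by do 2 (apply: cintegrable_sum => ?).
rewrite cexpect_sum => [|j]; last by apply: cintegrable_sum.
pose F (j k : nat) : R[i] :=
  sqrtC (lambda j / (2 * N)%:R) * sqrtC (lambda k / (2 * N)%:R) *
  (dft_root R N ^+ (j * a) * dft_root R N ^+ (k * b)) * 2.
transitivity (\sum_(j < N) \sum_(k < N) F j k * (j + k == N)%N%:R).
  apply: eq_bigr => j _; rewrite cexpect_sum//; apply: eq_bigr => k _.
  rewrite cexpectZ; last exact: cintegrable_algo_noiseM.
  by rewrite cexpect_algo_noiseM// mulrA.
rewrite sum_antidiag circ_kernel_sym; last first.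
  by move=> j jN; exact: relation_eigenvalC.
rewrite mulr_sumr big_nat_cond [RHS]big_nat_cond.
apply: eq_bigr => j /andP[/andP[j1 jN] _].
have jN' : (N - j < N)%N by rewrite ltn_subrL j1.
rewrite /F mul_sqrtC_scaled ?invr_ge0 ?ler0n//; last 2 first.
- exact: (lambda_ge0 (Ordinal jN)).
- exact: (lambda_ge0 (Ordinal jN')).
rewrite /relation_eigenval gtn_eqF// natrM invfM.
by field; rewrite pnatr_eq0.
Qed.

End OutputRelation.

Theorem proposition3p2 (R : realType) (Tm : realDomainType)
    (* the stationary process and its covariance function *)
    (d0 : measure_display) (Om0 : measurableType d0) (P0 : probability Om0 R)
    (X : Tm -> Om0 -> R[i]) (gamma : Tm -> R[i])
    (gaussX : complex_gaussian_process P0 X) (zeroX : zero_mean P0 X)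
    (statX : stationary P0 X) (covX : covariance_function P0 X gamma)
    (n m : nat) (n_gt0 : (1 <= n)%N) (le_nm : (n - 1 <= m)%N)
    (lambda_ge0 : forall k : 'I_(embed_size m), 0 <= embedding_eigenval gamma m k)
    (* the random variables used by the algorithm *)
    (d : measure_display) (Om : measurableType d) (P : probability Om R)
    (S T : 'I_m.+1 -> {RV P >-> R})
    (gaussS : forall k, standard_gaussian (S k))
    (gaussT : forall k, standard_gaussian (T k))
    (indepST : mutually_independent (I := ('I_m.+1 + 'I_m.+1)%type)
       (fun i => match i with inl k => S k | inr k => T k end)) :
  let Zt : Om -> 'cV[R[i]]_(embed_size m) := algo_output gamma S T in
  let Z : Om -> 'cV[R[i]]_n := fun w => first_entries (leq_embed_size le_nm) (Zt w) in
  let Ht : 'M[R[i]]_(embed_size m) := mxexpect P (fun w => Zt w *m (Zt w)^T) in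
  let H : 'M[R[i]]_n := mxexpect P (fun w => Z w *m (Z w)^T) in
  let Q : 'M[R[i]]_(embed_size m) := dftmx R m in
  let V : 'M[R[i]]_(embed_size m) := relation_diag gamma m in
  let lambda : nat -> R[i] := embedding_eigenval gamma m in
  (* the expectations defining Ht (hence H) exist *)
  (forall i j, cintegrable P (fun w => (Zt w *m (Zt w)^T) i j)) /\
  Ht = Q ^t Num.conj *m V *m Q /\
  H = top_left (leq_embed_size le_nm) Ht /\
  is_circulant (Q ^t Num.conj *m V *m Q) /\
  is_toeplitz H /\
  H \is hermsymmx /\
  (forall k : 'I_n, H (Ordinal n_gt0) k =
     (embed_size m)%:R^-1 *
     \sum_(1 <= j < embed_size m) sqrtC (lambda j * lambda (embed_size m - j)%N) *
                             dft_exp R (embed_size m) j k).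

Proof.
move=> Zt Z Ht H Q V lambda.
pose N := embed_size m; pose v := relation_eigenval gamma m.
have ZtP (i j : 'I_N) :=
  mxexpect_algo_output lambda_ge0 gaussS gaussT indepST i j.
have HtE i j : Ht i j = circ_kernel N v i j.
  by rewrite mxE (ZtP i j).2.
have QVQE i j : (Q ^t Num.conj *m V *m Q) i j = circ_kernel N v i j.
  exact: dftmx_conj_diag.
have HHt : H = top_left (leq_embed_size le_nm) Ht.
  apply/matrixP => i j; rewrite !mxE; congr cexpect; apply/funext => w.
  by rewrite !mxE; apply: eq_bigr => k _; rewrite !mxE.
have HE i j : H i j = circ_kernel N v i j.
  by rewrite HHt mxE HtE.
split; first by move=> i j; exact: (ZtP i j).1.
split; first by apply/matrixP => i j; rewrite HtE QVQE.
split; first exact: HHt.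
split; first exact: circ_kernel_circulant QVQE.
split; first by move=> i j i' j' ij; rewrite !HE; exact: circ_kernel_diff.
split.
  apply/is_hermitianmxP; rewrite expr0 scale1r; apply/matrixP => i j.
  transitivity (H j i)^*%R; last by rewrite [RHS]mxE [in RHS]mxE.
  rewrite !HE circ_kernel_conj// => l; exact: relation_eigenval_ge0.
move=> k; rewrite HE /circ_kernel; congr (_ * _).
rewrite big_nat_cond [RHS]big_nat_cond.
apply: eq_bigr => j /andP[/andP[j1 jN] _].
by rewrite muln0 expr0 invr1 mul1r dft_expE /v /relation_eigenval gtn_eqF.
Qed.
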